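(* Let $G$ be a finite group, let $1\leq p<\infty$, let $\varepsilon>0$, let $n$ be a positive integer, and let $\rho,\sigma:G\to U(n)$ be two unitary representations such that $\|\rho(x)-\sigma(x)\|_p'\leq\varepsilon$ for all $x\in G$. Then there exists a $2\varepsilon$-unitary matrix $T'\in M_n(\mathbb{C})$ such that $\|T'-I_n\|_p'\leq 3\varepsilon$ and $\rho(x)T'=T'\sigma(x)$ for every $x\in G$. Moreover, there is a representation $\tau$ of $G$ of dimension at least $(1-(2\varepsilon)^p)n$ that is a component of both $\rho$ and $\sigma$ (that is, $\tau$ is equivalent to a subrepresentation of $\rho$ and to a subrepresentation of $\sigma$).
   Context: For $A\in M_n(\mathbb{C})$ with singular values $\lambda_1,\dots,\lambda_n$, the normalized Schatten $p$-norm is $\|A\|_p'=\left(\frac1n\sum_{i=1}^n\lambda_i^p\right)^{1/p}$. For $\eta\ge 0$, a matrix $U\in M_n(\mathbb{C})$ is called $\eta$-unitary (with respect to $\|\cdot\|_p'$) if all its singular values are $0$ or $1$ and $\|UU^*-I_n\|_p'\leq\eta$. *)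

(* Defs.v *)
From mathcomp Require Export all_boot all_order all_algebra.
From mathcomp Require Export all_fingroup mxrepresentation.
From mathcomp Require Export complex.
From mathcomp Require Export reals exp.

Set Implicit Arguments.
Unset Strict Implicit.
Unset Printing Implicit Defensive.

Import Order.TTheory GRing.Theory Num.Theory.

Local Open Scope ring_scope.
Local Open Scope complex_scope.
Local Open Scope sesquilinear_scope.

(* [A^t* *m A] is Hermitian, so [spectral_diag] lists its eigenvalues with
   multiplicity (in an unspecified order); they are nonnegative reals, and
   [complex.Re] only changes their type from R[i] to R. *)
Definition singular_value (R : realType) (n : nat) (A : 'M[R[i]]_n)
    (i : 'I_n) : R :=
  Num.sqrt (complex.Re (spectral_diag (A^t* *m A) 0 i)).

Definition schatten_norm (R : realType) (p : R) (n : nat) (A : 'M[R[i]]_n) : R :=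
  (n%:R^-1 * \sum_(i < n) singular_value A i `^ p) `^ p^-1.

Definition eta_unitary (R : realType) (p eta : R) (n : nat)
    (U : 'M[R[i]]_n) : Prop :=
  (forall i : 'I_n, singular_value U i = 0 \/ singular_value U i = 1) /\
  schatten_norm p (U *m U^t* - 1%:M) <= eta.

Definition unitary_repr (R : realType) (gT : finGroupType) (G : {group gT})
    (n : nat) (rho : mx_representation R[i] G n) : Prop :=
  forall x, x \in G -> rho x \is unitarymx.

(* In [mxrepresentation] matrices act on row vectors: a subrepresentation is a
   row space U with U *m rho x included in U for all x in G. *)
Definition component (R : realType) (gT : finGroupType) (G : {group gT})
    (m n : nat) (tau : mx_representation R[i] G m)
    (rho : mx_representation R[i] G n) : Prop :=
  exists (U : 'M[R[i]]_n) (modU : mxmodule rho U),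
    mx_rsim tau (submod_repr modU).

(* Main.v *)
(* Let T be the average of rho(x) sigma(x)^* over G. It intertwines rho and
   sigma, and convexity of the norm gives |T - 1| <= eps and
   |T^* T - 1| <= 2 eps. The partial isometry T' in the polar decomposition of T
   still intertwines, and since |1 - s| and [s = 0] are both at most |1 - s^2|,
   both |T' - T| and |T' T'^* - 1| are at most |T^* T - 1|. The initial and
   final spaces of T' carry the common component tau.
   All norm inequalities come from one variational principle: the sum of the
   p-th powers of the singular values of A is the maximum over contractions
   U, V of the sum of the |(U A V)_ii|^p. *)

Require Import Defs.
From mathcomp Require Import ring lra.

Set Implicit Arguments.
Unset Strict Implicit.
Unset Printing Implicit Defensive.

Import Order.TTheory GRing.Theory Num.Theory.
Import ComplexField.Normc.

Local Open Scope ring_scope.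
Local Open Scope complex_scope.
Local Open Scope sesquilinear_scope.

(** * Convexity of t^p, and Schatten bounds with the root and normalization removed *)

Lemma powR_tangent_le (R : realType) (p x m : R) : 1 <= p -> 0 <= x -> 0 <= m ->
  p * m `^ (p - 1) * x <= x `^ p + (p - 1) * m `^ p.
Proof.
move=> p1 x0 m0; have [->|pN1] := eqVneq p 1.
  by rewrite subrr powRr0 !powRr1 // mul0r addr0 !mul1r.
have {pN1}p1 : 1 < p by rewrite lt_neqAle eq_sym pN1.
have p0 : 0 < p by lra.
have r0 : 0 < p - 1 by lra.
(* Young's inequality for [x] and m^(p-1) with conjugate exponents p and p/(p-1); multiplied by p it
   says that t^p lies above its tangent at [m]. The case p = 1, which has no finite conjugate
   exponent, was split off above. *)
have := @conjugate_powR _ x (m `^ (p - 1)) p (p / (p - 1)) x0 (powR_ge0 _ _) p0.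
rewrite -powRrM mulrCA divff ?mulr1 ?gt_eqF // => /(_ (divr_gt0 p0 r0)).
have -> : p^-1 + (p / (p - 1))^-1 = 1 by field; rewrite !gt_eqF.
move=> /(_ erefl) /(ler_wpM2l (ltW p0)) h.
rewrite -mulrA [_ * x]mulrC; apply: (le_trans h).
rewrite le_eqVlt; apply/orP; left; apply/eqP; field; by rewrite !gt_eqF.
Qed.

(** Averages the tangent inequalities at the weighted mean [m]. If the weights sum to less than 1,
    the leftover term is (p-1) m^p times the missing mass, which has the right sign. *)
Lemma powR_jensen (R : realType) (p : R) (I : finType) (w x : I -> R) :
  1 <= p -> (forall i, 0 <= w i) -> \sum_i w i <= 1 -> (forall i, 0 <= x i) ->
  (\sum_i w i * x i) `^ p <= \sum_i w i * x i `^ p.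
Proof.
move=> p1 w0 w1 x0; set m := \sum_i w i * x i.
have m0 : 0 <= m by apply: sumr_ge0 => i _; apply: mulr_ge0.
have h : \sum_i w i * (p * m `^ (p - 1) * x i - (p - 1) * m `^ p) <=
         \sum_i w i * x i `^ p.
  apply: ler_sum => i _; apply: ler_wpM2l => //.
  by rewrite lerBlDr; apply: powR_tangent_le.
apply: le_trans h.
have -> : \sum_i w i * (p * m `^ (p - 1) * x i - (p - 1) * m `^ p) =
          p * (m * m `^ (p - 1)) - (p - 1) * m `^ p * \sum_i w i.
  rewrite (eq_bigr (fun i => p * m `^ (p - 1) * (w i * x i) -
    (p - 1) * m `^ p * w i)); last by move=> i _; ring.
  by rewrite sumrB -!mulr_sumr -/m; ring.
rewrite mulr_powRB1 //; last by lra.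
have : 0 <= (p - 1) * m `^ p * (1 - \sum_i w i).
  by rewrite !mulr_ge0 ?powR_ge0 ?subr_ge0.
set s := \sum_i w i => h'; rewrite -subr_ge0 (le_trans h') // le_eqVlt.
by apply/orP; left; apply/eqP; ring.
Qed.

Lemma schatten_norm_leE (R : realType) (p a : R) (n : nat) (A : 'M[R[i]]_n) :
  (0 < n)%N -> 1 <= p -> 0 <= a ->
  (schatten_norm p A <= a) =
  (\sum_(i < n) singular_value A i `^ p <= n%:R * a `^ p).
Proof.
move=> n0 p1 a0; have p0 : 0 < p by lra.
have nR : 0 < n%:R :> R by rewrite ltr0n.
rewrite /schatten_norm; set S := \sum_i _.
have S0 : 0 <= S by apply: sumr_ge0 => i _; apply: powR_ge0.
have S1 : 0 <= n%:R^-1 * S by rewrite mulr_ge0 // invr_ge0 ltW.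
rewrite -ler_pdivrMl //; apply/idP/idP => h.
  have /(ge0_ler_powR (ltW p0)) : (n%:R^-1 * S) `^ p^-1 \in Num.nneg.
    by rewrite nnegrE powR_ge0.
  move=> /(_ _ _ h); rewrite -powRrM mulVf ?gt_eqF // powRr1 //.
  by apply; rewrite nnegrE.
have /(@ge0_ler_powR R p^-1) : n%:R^-1 * S \in Num.nneg by rewrite nnegrE.
rewrite invr_ge0 (ltW p0) => /(_ isT _ _ h).
rewrite -powRrM mulfV ?gt_eqF // powRr1 //; apply; by rewrite nnegrE powR_ge0.
Qed.

(** * Adjoints, squared norms and contractions *)

Section Adjoint.
Variable C : numClosedFieldType.

Lemma adjmxM m n q (A : 'M[C]_(m, n)) (B : 'M[C]_(n, q)) :
  (A *m B)^t* = B^t* *m A^t*.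
Proof. by rewrite trmx_mul map_mxM. Qed.

Lemma adjmxB m n (A B : 'M[C]_(m, n)) : (A - B)^t* = A^t* - B^t*.
Proof. by rewrite linearB /= map_mxB. Qed.

Lemma adjmx1 n : (1%:M : 'M[C]_n)^t* = 1%:M.
Proof. by rewrite trmx1 map_mx1. Qed.

Lemma entryB m n (A B : 'M[C]_(m, n)) i j : (A - B) i j = A i j - B i j.
Proof. by rewrite !mxE. Qed.

Definition sqnorm n (v : 'rV[C]_n) : C := (v *m v^t*) 0 0.

Lemma sqnormE n (v : 'rV[C]_n) : sqnorm v = \sum_k `|v 0 k| ^+ 2.
Proof. by rewrite /sqnorm mxE; apply: eq_bigr => k _; rewrite !mxE normCK. Qed.

Lemma sqnorm_ge0 n (v : 'rV[C]_n) : 0 <= sqnorm v.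
Proof. by rewrite sqnormE sumr_ge0 // => k _; rewrite exprn_ge0. Qed.

Lemma gram_diagE m n (B : 'M[C]_(m, n)) k :
  (B^t* *m B) k k = \sum_i `|B i k| ^+ 2.
Proof. by rewrite mxE; apply: eq_bigr => i _; rewrite !mxE mulrC normCK. Qed.

(** The diagonal of the Gram matrix holds the squared norms of the columns. *)
Lemma gram_eq0 m n (B : 'M[C]_(m, n)) : B^t* *m B = 0 -> B = 0.
Proof.
move=> B0; apply/matrixP => i k; rewrite mxE; apply/eqP.
have /eqP := gram_diagE B k; rewrite B0 mxE eq_sym psumr_eq0; last first.
  by move=> j _; rewrite exprn_ge0.
by move=> /allP /(_ i); rewrite mem_index_enum sqrf_eq0 normr_eq0 => /(_ isT).
Qed.

(** Operator norm at most 1, tested on row vectors because matrices act on the right. *)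
Definition contraction n (X : 'M[C]_n) :=
  forall v : 'rV[C]_n, sqnorm (v *m X) <= sqnorm v.

Lemma contractionM n (X Y : 'M[C]_n) :
  contraction X -> contraction Y -> contraction (X *m Y).
Proof. by move=> cX cY v; rewrite mulmxA (le_trans (cY _)). Qed.

(* With w = v X^*, expand 0 <= |v - w X|^2 = |v|^2 - 2 |w|^2 + |w X|^2. *)
Lemma contraction_adj n (X : 'M[C]_n) : contraction X -> contraction (X^t*).
Proof.
move=> cX v; set w := v *m X^t*; have := sqnorm_ge0 (v - w *m X).
have -> : sqnorm (v - w *m X) = sqnorm v - sqnorm w *+ 2 + sqnorm (w *m X).
  rewrite /sqnorm adjmxB mulmxBl !mulmxBr 2!entryB entryB.
  have -> : v *m (w *m X)^t* = w *m w^t* by rewrite adjmxM mulmxA.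
  have -> : w *m X *m v^t* = w *m w^t*.
    by rewrite {2}/w adjmxM trmxCK mulmxA.
  by ring.
have := cX w; set a := sqnorm v; set b := sqnorm w; set c := sqnorm _.
move=> cb h; rewrite -subr_ge0; apply: (le_trans h).
rewrite -subr_ge0; have -> : a - b - (a - b *+ 2 + c) = b - c by ring.
by rewrite subr_ge0.
Qed.

Lemma unitarymx_contraction n (X : 'M[C]_n) : X \is unitarymx -> contraction X.
Proof.
by move=> /unitarymxP uX v; rewrite /sqnorm adjmxM mulmxA -(mulmxA v) uX mulmx1.
Qed.

Lemma contraction1 n : contraction (1%:M : 'M[C]_n).
Proof. by move=> v; rewrite mulmx1. Qed.

(** [Q], that is 1 - X X^*, is an orthogonal projection, and |v|^2 - |v X|^2 = |v Q|^2. *)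
Lemma partial_isometry_contraction n (X : 'M[C]_n) :
  X *m X^t* *m X = X -> contraction X.
Proof.
move=> hX v; rewrite -subr_ge0.
suff -> : sqnorm v - sqnorm (v *m X) = sqnorm (v *m (1%:M - X *m X^t*)).
  exact: sqnorm_ge0.
set Q := 1%:M - _.
have QQ : Q *m Q^t* = Q.
  rewrite /Q adjmxB adjmx1 adjmxM trmxCK mulmxBr mulmx1 mulmxBl mul1mx.
  by rewrite !mulmxA hX subrr subr0.
rewrite /sqnorm -entryB; congr (_ 0 0).
by rewrite !adjmxM !mulmxA -(mulmxA v Q) QQ /Q mulmxBr mulmx1 mulmxBl !mulmxA.
Qed.

Lemma contraction_row n (X : 'M[C]_n) i : contraction X ->
  \sum_k `|X i k| ^+ 2 <= 1.
Proof.
move=> /(_ (delta_mx 0 i)); rewrite -rowE !sqnormE.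
have -> : \sum_k `|(delta_mx 0 i : 'rV[C]_n) 0 k| ^+ 2 = 1.
  rewrite (bigD1 i) //= big1 ?mxE ?eqxx ?addr0 ?normr1 ?expr1n // => k /negPf ki.
  by rewrite mxE ki andbF normr0 expr0n.
by under eq_bigr do rewrite mxE.
Qed.

Lemma contraction_col n (X : 'M[C]_n) k : contraction X ->
  \sum_i `|X i k| ^+ 2 <= 1.
Proof.
move=> /contraction_adj /(@contraction_row _ _ k).
by under eq_bigr do rewrite !mxE norm_conjC.
Qed.

End Adjoint.

(** * Diagonal matrices and what commutes with them *)

Section Diagonal.
Variables (C : numClosedFieldType) (n : nat).
Implicit Types (d : 'rV[C]_n) (Y : 'M[C]_n).

Lemma diag_mx_adj d : (forall k, d 0 k \is Num.real) ->
  (diag_mx d)^t* = diag_mx d.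
Proof.
move=> dR; rewrite tr_diag_mx map_diag_mx; congr diag_mx.
by apply/rowP => k; rewrite mxE; apply/CrealP.
Qed.

(** Entrywise, commutation says that [Y i j] vanishes unless the diagonal entries i and j of [d]
    agree, and then those of [d'] agree too. *)
Lemma diag_mx_commute d d' Y :
  (forall i j, d 0 i = d 0 j -> d' 0 i = d' 0 j) ->
  Y *m diag_mx d = diag_mx d *m Y -> Y *m diag_mx d' = diag_mx d' *m Y.
Proof.
move=> dd' /matrixP cY; apply/matrixP => i j.
have := cY i j; rewrite !mul_mx_diag !mul_diag_mx !mxE => /eqP.
rewrite mulrC -subr_eq0 -mulrBl mulf_eq0 subr_eq0 => /orP[/eqP /dd' ->|/eqP ->].
  by rewrite mulrC.
by rewrite mul0r mulr0.
Qed.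

End Diagonal.

(** * Singular value decomposition of a square matrix *)

Section SVD.
Variables (C : numClosedFieldType) (n : nat) (A : 'M[C]_n).

(** The singular values kept in [C], so that they enter matrix products directly; [svE] identifies
    them with the real [singular_value]. *)
Definition sv : 'rV[C]_n := map_mx sqrtC (spectral_diag (A^t* *m A)).

Definition sv_row (f : C -> C) : 'rV[C]_n := map_mx f sv.

Lemma sv_rowE f k : sv_row f 0 k = f (sv 0 k).
Proof. by rewrite mxE. Qed.

Definition right_sv := spectralmx (A^t* *m A).

(* The columns belonging to singular values [0] vanish, since [0^-1 = 0]. *)
Definition left_sv := A *m right_sv^t* *m diag_mx (sv_row GRing.inv).

Let P := right_sv.

Lemma right_sv_unitary : right_sv \is unitarymx.
Proof. exact: spectral_unitarymx. Qed.

(** The columns of A P^* are thus orthogonal. Nonnegativity of the eigenvalues and the decomposition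
    itself are both read off from this. *)
Lemma spectral_gram :
  (A *m P^t*)^t* *m (A *m P^t*) = diag_mx (spectral_diag (A^t* *m A)).
Proof.
have uP : P \is unitarymx by apply: spectral_unitarymx.
have /orthomx_spectralP E : A^t* *m A \is normalmx.
  by apply/normalmxP; rewrite !adjmxM trmxCK.
rewrite adjmxM trmxCK mulmxA -(mulmxA P) [in X in P *m X]E -/P invmx_unitary //.
by rewrite !mulmxA (unitarymxP uP) mul1mx mulmxtVK.
Qed.

Lemma sv_ge0 k : 0 <= sv 0 k.
Proof.
rewrite mxE sqrtC_ge0; have := gram_diagE (A *m P^t*) k.
rewrite spectral_gram mxE eqxx mulr1n => ->.
by rewrite sumr_ge0 // => i _; rewrite exprn_ge0.
Qed.

Lemma sv_row_mul f g :
  diag_mx (sv_row f) *m diag_mx (sv_row g) =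
  diag_mx (sv_row (fun x => f x * g x)).
Proof. by rewrite mulmx_diag; congr diag_mx; apply/rowP => k; rewrite !mxE. Qed.

Lemma eq_sv_row f g : (forall x, f x = g x) -> sv_row f = sv_row g.
Proof. by move=> fg; apply/rowP => k; rewrite !mxE fg. Qed.

Lemma spectral_diag_gram : spectral_diag (A^t* *m A) = sv_row (fun x => x * x).
Proof. by apply/rowP => k; rewrite !mxE -expr2 sqrtCK. Qed.

Lemma gram_svd : A^t* *m A = P^t* *m diag_mx (sv_row (fun x => x * x)) *m P.
Proof.
rewrite -spectral_diag_gram -spectral_gram adjmxM trmxCK.
rewrite !mulmxA -!(mulmxA _ (P^t*) P) (mulmx1C (unitarymxP right_sv_unitary)).
by rewrite !mul1mx !mulmx1.
Qed.

Lemma gram_svd_sub1 :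
  P *m (A^t* *m A - 1%:M) *m P^t* = diag_mx (sv_row (fun x => x * x - 1)).
Proof.
have uP := right_sv_unitary.
rewrite gram_svd mulmxBr mulmx1 mulmxBl (unitarymxP uP) !mulmxA.
rewrite (unitarymxP uP) mul1mx mulmxtVK //.
by apply/matrixP => i j; rewrite !mxE; case: eqP; rewrite ?mulr0n ?subr0.
Qed.

Lemma mxtrace_gram : \tr (A^t* *m A) = \sum_k sv 0 k ^+ 2.
Proof.
rewrite gram_svd mxtrace_mulC mulmxA (unitarymxP right_sv_unitary) mul1mx.
by rewrite mxtrace_diag; apply: eq_bigr => k _; rewrite mxE.
Qed.

(** Scaling the eigenvalue s^2 by s^-1 on both sides gives 1, except that s = 0 gives 0; so
    [left_sv] is a partial isometry, not always a unitary. *)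
Lemma left_sv_gram :
  left_sv^t* *m left_sv = diag_mx (sv_row (fun x => (x != 0)%:R)).
Proof.
have adjV : (diag_mx (sv_row GRing.inv))^t* = diag_mx (sv_row GRing.inv).
  by apply: diag_mx_adj => k; rewrite mxE rpredV ger0_real ?sv_ge0.
rewrite /left_sv [in X in X *m _]adjmxM adjV -mulmxA (mulmxA _ (A *m _)).
rewrite spectral_gram spectral_diag_gram !sv_row_mul.
congr diag_mx; apply: eq_sv_row => x; have [->|x0] := eqVneq x 0.
  by rewrite invr0 mul0r.
by rewrite mulfK // mulVf.
Qed.

(** Only the columns of A P^* with singular value 0, which [left_sv] drops, could make a difference;
    the Gram matrix of that difference is zero. *)
Lemma svd : A = left_sv *m diag_mx sv *m P.
Proof.
have svE : sv = sv_row id by rewrite /sv_row map_mx_id.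
have E : A *m P^t* = left_sv *m diag_mx sv.
  apply/eqP; rewrite -subr_eq0; apply/eqP/gram_eq0; rewrite svE.
  rewrite /left_sv -(mulmxA (A *m _)) sv_row_mul -[X in X - _]mulmx1 -mulmxBr.
  rewrite adjmxM -mulmxA (mulmxA _ (A *m _)) spectral_gram spectral_diag_gram.
  rewrite mulmxBr mulmx1 sv_row_mul.
  suff -> : sv_row (fun x => x * x * (x^-1 * x)) = sv_row (fun x => x * x).
    by rewrite subrr mulmx0.
  apply: eq_sv_row => x; have [->|x0] := eqVneq x 0; first by rewrite !mul0r.
  by rewrite mulVf // mulr1.
by rewrite -E mulmxKtV // right_sv_unitary.
Qed.

Lemma mulmx_svd (U V : 'M[C]_n) :
  U *m A *m V = (U *m left_sv) *m diag_mx sv *m (P *m V).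
Proof.
rewrite [in LHS]svd -(mulmxA left_sv) (mulmxA U left_sv) (mulmxA _ _ P).
by rewrite -mulmxA.
Qed.

Lemma left_sv_supp_id :
  left_sv *m diag_mx (sv_row (fun x => (x != 0)%:R)) = left_sv.
Proof.
rewrite /left_sv -mulmxA sv_row_mul; congr (_ *m diag_mx _).
apply: eq_sv_row => x; have [->|x0] := eqVneq x 0; first by rewrite invr0 mul0r.
by rewrite mulr1.
Qed.

(** Gives the pair of contractions at which the variational principle is attained. *)
Lemma svd_diag : left_sv^t* *m A *m P^t* = diag_mx sv.
Proof.
rewrite [X in _ *m X *m _]svd -(mulmxA left_sv) (mulmxA _ left_sv) left_sv_gram.
rewrite (mulmxA _ _ P) mulmxtVK ?right_sv_unitary // mulmx_diag; congr diag_mx.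
apply/rowP => k; rewrite mxE sv_rowE.
by have [->|_] := eqVneq; rewrite ?mulr0 ?mul1r.
Qed.

Lemma left_sv_contraction : contraction left_sv.
Proof.
apply: partial_isometry_contraction.
by rewrite -mulmxA left_sv_gram left_sv_supp_id.
Qed.

Lemma right_sv_contraction : contraction right_sv.
Proof. exact/unitarymx_contraction/right_sv_unitary. Qed.

(** Conjugated by [P], idempotence reads s^4 = s^2 for each singular value, and s >= 0 excludes s =
    -1. *)
Lemma idempotent_gram_sv k :
  (A^t* *m A) *m (A^t* *m A) = A^t* *m A -> sv 0 k = 0 \/ sv 0 k = 1.
Proof.
have uP := right_sv_unitary; set D := diag_mx (sv_row (fun x => x * x)).
have E : P *m (A^t* *m A) *m P^t* = D.
  by rewrite gram_svd !mulmxA (unitarymxP uP) mul1mx mulmxtVK.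
move=> gramA; have : D *m D = D.
  rewrite -E -[in RHS]gramA !mulmxA -(mulmxA _ (P^t*) P).
  by rewrite (mulmx1C (unitarymxP uP)) mulmx1.
rewrite sv_row_mul => /matrixP /(_ k k).
rewrite mxE [RHS]mxE eqxx !mulr1n !sv_rowE.
have := sv_ge0 k; set s := sv 0 k => s0 /eqP; rewrite -subr_eq0.
have -> : s * s * (s * s) - s * s = s * s * ((s - 1) * (s + 1)) by ring.
rewrite !mulf_eq0 orbb => /or3P[/eqP ->|h|h]; first by left.
  by right; apply/eqP; rewrite -subr_eq0.
by rewrite gt_eqF ?ltr_wpDl in h.
Qed.

End SVD.

(** * The partial isometry of the polar decomposition and its rank *)

Lemma mxrank_diag_le (F : fieldType) n (d : 'rV[F]_n) :
  (\rank (diag_mx d) <= \sum_k (d 0%R k != 0%R))%N.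
Proof.
rewrite diag_mx_sum_delta.
elim/big_rec2: _ => [|k m M _ h]; first by rewrite mxrank0.
apply: leq_trans (mxrank_add _ _) _; apply: leq_add h.
have [->|_] := eqVneq; first by rewrite scale0r mxrank0.
by rewrite (leq_trans (mxrank_scale _ _)) // mxrank_delta.
Qed.

Section PolarPart.
Variables (C : numClosedFieldType) (n : nat) (A : 'M[C]_n).
Let P := right_sv A.
Let L := left_sv A.
Let uP : P \is unitarymx := right_sv_unitary A.

(** The factor U in A = U |A|, where |A| is P^* S P with S the diagonal matrix of singular values:
    in the product U |A| the inner P P^* cancels. *)
Definition polar_part := L *m P.

Let support := diag_mx (sv_row A (fun x => (x != 0)%:R)).

Lemma polar_part_gram : polar_part^t* *m polar_part = P^t* *m support *m P.
Proof.
by rewrite /polar_part adjmxM mulmxA -(mulmxA _ (L^t*)) left_sv_gram.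
Qed.

Lemma polar_part_gram_idem :
  (polar_part^t* *m polar_part) *m (polar_part^t* *m polar_part) =
  polar_part^t* *m polar_part.
Proof.
rewrite polar_part_gram !mulmxA -(mulmxA _ P) (unitarymxP uP) mulmx1.
rewrite -(mulmxA _ support support) sv_row_mul; congr (_ *m diag_mx _ *m _).
by apply: eq_sv_row => x; case: (x != 0); rewrite ?mulr0 ?mulr1.
Qed.

Lemma polar_partK : polar_part *m polar_part^t* *m polar_part = polar_part.
Proof.
rewrite -mulmxA polar_part_gram /polar_part !(mulmxA (L *m P)).
by rewrite mulmxtVK // left_sv_supp_id.
Qed.

(** [- E] is an orthogonal projection, so [E] is self-adjoint with E^2 = - E and its singular values
    are 0 or 1. *)
Let E := polar_part *m polar_part^t* - 1%:M.

Lemma polar_part_coker_gram : E^t* *m E = - E.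
Proof.
have -> : E^t* = E by rewrite adjmxB adjmxM trmxCK adjmx1.
rewrite {1}/E mulmxBl mul1mx [_ *m E]mulmxBr mulmx1 mulmxA polar_partK.
by rewrite subrr sub0r.
Qed.

Lemma polar_part_coker_idem : (E^t* *m E) *m (E^t* *m E) = E^t* *m E.
Proof.
have Eadj : E^t* = E by rewrite adjmxB adjmxM trmxCK adjmx1.
have := polar_part_coker_gram; rewrite Eadj => EE.
by rewrite EE mulNmx mulmxN opprK.
Qed.

(** By cyclicity of the trace, U U^* has the same trace as U^* U, namely the number of nonzero
    singular values of [A]. *)
Lemma mxtrace_polar_part_coker :
  \tr (E^t* *m E) = \sum_k (sv A 0 k == 0)%:R.
Proof.
rewrite polar_part_coker_gram raddfN raddfB /= mxtrace1 mxtrace_mulC.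
rewrite polar_part_gram mxtrace_mulC mulmxA (unitarymxP uP) mul1mx mxtrace_diag.
have -> : n%:R = \sum_(k < n) 1 :> C by rewrite sumr_const card_ord.
rewrite opprB -sumrB; apply: eq_bigr => k _; rewrite mxE.
by case: eqP; rewrite ?subr0 ?subrr.
Qed.

Lemma polar_part_sub :
  polar_part - A = L *m diag_mx (sv_row A (fun x => 1 - x)) *m P.
Proof.
rewrite [X in _ - X]svd -/L -/P /polar_part -mulmxBl; congr (_ *m _).
rewrite -[X in X - _]mulmx1 -mulmxBr; congr (_ *m _).
rewrite -diag_const_mx -raddfB; congr diag_mx; apply/rowP => k.
by rewrite sv_rowE mxE [X in X + _]mxE [X in _ + X]mxE.
Qed.

(* [P Y P^*] commutes with the diagonal matrix of squared singular values,
   hence with any diagonal matrix that is a function of it. *)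
Lemma polar_part_intertwine (X Y : 'M[C]_n) :
  X *m A = A *m Y -> A^t* *m A *m Y = Y *m (A^t* *m A) ->
  X *m polar_part = polar_part *m Y.
Proof.
move=> XA; rewrite gram_svd -/P => comm.
set Z := P *m Y *m P^t*; set D := diag_mx _ in comm.
have ZD : Z *m D = D *m Z.
  rewrite /Z; move/(congr1 (fun M => P *m M *m P^t*)): comm.
  by rewrite !mulmxA (unitarymxP uP) mul1mx mulmxtVK // => <-.
have ZV : Z *m diag_mx (sv_row A GRing.inv) = diag_mx (sv_row A GRing.inv) *m Z.
  apply: diag_mx_commute ZD => i j; rewrite !sv_rowE -!expr2.
  by move/eqP; rewrite eqrXn2 ?sv_ge0 // => /eqP ->.
have YP : P *m Y = Z *m P by rewrite /Z mulmxKtV.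
have YP' : Y *m P^t* = P^t* *m Z.
  by rewrite /Z !mulmxA -(mulmxA _ Y) (mulmx1C (unitarymxP uP)) mul1mx.
rewrite /polar_part -(mulmxA L) YP (mulmxA L) mulmxA; congr (_ *m P).
rewrite /L /left_sv -/P -(mulmxA _ _ Z) -ZV !mulmxA XA.
by rewrite -(mulmxA A Y) YP' !mulmxA.
Qed.

(** The identity is U^* U plus the spectral projection for singular value 0; rank is subadditive and
    does not grow under products. *)
Lemma mxrank_polar_part :
  (n <= \rank polar_part + \sum_k (sv A 0%R k == 0%R))%N.
Proof.
rewrite -{1}(mxrank1 C n).
have -> : 1%:M = polar_part^t* *m polar_part +
    P^t* *m diag_mx (sv_row A (fun x => (x == 0)%:R)) *m P.
  rewrite polar_part_gram -mulmxDl -mulmxDr -raddfD /=.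
  suff -> : sv_row A (fun x => (x != 0)%:R) + sv_row A (fun x => (x == 0)%:R)
            = const_mx 1.
    by rewrite diag_const_mx mulmx1 (mulmx1C (unitarymxP uP)).
  apply/rowP => k; rewrite mxE [RHS]mxE !sv_rowE.
  by case: eqP => _ /=; rewrite ?add0r ?addr0.
apply: leq_trans (mxrank_add _ _) _; apply: leq_add; first exact: mxrankM_maxr.
apply: leq_trans (mxrankM_maxl _ _) _; apply: leq_trans (mxrankM_maxr _ _) _.
apply: leq_trans (mxrank_diag_le _) _; apply: leq_sum => k _.
by rewrite sv_rowE; case: (sv A 0 k == 0); rewrite ?leq_b1 ?eqxx.
Qed.

End PolarPart.

(** * Intertwiners, subrepresentations and the averaged operator *)

Lemma mx_rsim_submod (F : fieldType) (gT : finGroupType) (G : {group gT})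
    (n1 n2 : nat) (rG1 : mx_representation F G n1)
    (rG2 : mx_representation F G n2) (U : 'M[F]_n1) (V : 'M[F]_n2)
    (f : 'M[F]_(n1, n2)) (modU : mxmodule rG1 U) (modV : mxmodule rG2 V) :
  (forall x, x \in G -> rG1 x *m f = f *m rG2 x) ->
  (U *m f :=: V)%MS -> \rank V = \rank U ->
  mx_rsim (submod_repr modU) (submod_repr modV).
Proof.
move=> homf defV rankV; set W := val_submod (U := U) 1%:M *m f.
have eqW : (W :=: V)%MS by apply: eqmx_trans (eqmxMr _ (val_submod1 U)) defV.
have sWV : (W <= V)%MS by rewrite eqW.
(* The rows of [W] are the images under [f] of the chosen basis of [U]; in coordinates of [V] they
   form the matrix of the equivalence, invertible since the ranks agree. *)
exists (in_submod V W) => [||x Gx]; first by rewrite rankV.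
  by rewrite /row_free mxrank_in_submod // eqW rankV.
rewrite -in_submodJ // in_submodE mulmxA -in_submodE; congr in_submod.
rewrite /W mulmxA -val_submodE -[submod_repr _ _]mul1mx val_submodJ //.
by rewrite -!mulmxA homf.
Qed.

Section Unitary.
Variables (C : numClosedFieldType) (gT : finGroupType) (G : {group gT}) (n : nat).

Implicit Type tau : mx_representation C G n.

Lemma unitary_adj tau x : (forall x, x \in G -> tau x \is unitarymx) ->
  x \in G -> (tau x)^t* = tau x^-1%g.
Proof. by move=> u Gx; rewrite repr_mxV // invmx_unitary ?u. Qed.

Variables rho sigma : mx_representation C G n.
Hypotheses (urho : forall x, x \in G -> rho x \is unitarymx)
  (usigma : forall x, x \in G -> sigma x \is unitarymx).

(** Take the adjoint of the relation at x^-1: in a unitary representation the adjoint at x^-1 is the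
    value at x. *)
Lemma intertwine_adj (A : 'M[C]_n) :
  (forall x, x \in G -> rho x *m A = A *m sigma x) ->
  forall x, x \in G -> sigma x *m A^t* = A^t* *m rho x.
Proof.
move=> hA x Gx; have GxV : x^-1%g \in G by rewrite groupV.
have := congr1 (fun M => M^t*) (hA _ GxV).
by rewrite !adjmxM !unitary_adj // invgK.
Qed.

Lemma polar_part_hom (A : 'M[C]_n) :
  (forall x, x \in G -> rho x *m A = A *m sigma x) ->
  forall x, x \in G -> rho x *m polar_part A = polar_part A *m sigma x.
Proof.
move=> hA x Gx; apply: polar_part_intertwine; first exact: hA.
(* A^* A commutes with [sigma x]: move [sigma x] past [A], then past its adjoint. *)
by rewrite mulmxA intertwine_adj // -!mulmxA hA.
Qed.

(** The row spaces of U^* and U are stable under [rho] and [sigma], and right multiplication by [U]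
    carries the first onto the second because U = U U^* U. *)
Lemma partial_isometry_rsim (U : 'M[C]_n) :
  U *m U^t* *m U = U -> (forall x, x \in G -> rho x *m U = U *m sigma x) ->
  exists (V W : 'M[C]_n) (modV : mxmodule rho V) (modW : mxmodule sigma W),
    \rank V = \rank U /\ mx_rsim (submod_repr modV) (submod_repr modW).
Proof.
move=> hU homU; have homV := intertwine_adj homU.
have modV : mxmodule rho (U^t*).
  by apply/mxmoduleP => x Gx; rewrite -homV // submxMl.
have modU : mxmodule sigma U.
  by apply/mxmoduleP => x Gx; rewrite -homU // submxMl.
have defU : (U^t* *m U :=: U)%MS.
  by apply/eqmxP; rewrite submxMl -{1}hU -mulmxA submxMl.
have rkU : \rank (U^t*) = \rank U by rewrite mxrank_map mxrank_tr.
exists (U^t*), U, modV, modU; split=> //.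
by apply: (mx_rsim_submod _ _ homU defU); rewrite rkU.
Qed.

(** For unitary [sigma] the inverse is the adjoint; writing the inverse reduces the intertwining
    property to a reindexing of the group. *)
Definition intertwiner := #|G|%:R^-1 *: \sum_(x in G) rho x *m sigma x^-1%g.

Lemma intertwinerP y : y \in G ->
  rho y *m intertwiner = intertwiner *m sigma y.
Proof.
move=> Gy; rewrite -scalemxAr -scalemxAl mulmx_sumr mulmx_suml; congr (_ *: _).
rewrite [RHS](reindex_inj (mulgI y)) /=; apply: eq_big => x.
  by rewrite groupMl.
move=> Gx; rewrite invMg !repr_mxM ?groupV //.
by rewrite -!mulmxA -repr_mxM ?groupV // mulVg repr_mx1 mulmx1.
Qed.

Lemma avg_sub (F : gT -> 'M[C]_n) (B : 'M[C]_n) :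
  #|G|%:R^-1 *: (\sum_(x in G) F x) - B = #|G|%:R^-1 *: \sum_(x in G) (F x - B).
Proof.
rewrite sumrB scalerBr sumr_const; congr (_ - _).
rewrite -(scaler_nat _ B) scalerA mulVf ?scale1r //.
by rewrite pnatr_eq0 -lt0n cardG_gt0.
Qed.

Lemma intertwiner_adj :
  intertwiner^t* = #|G|%:R^-1 *: \sum_(x in G) sigma x *m rho x^-1%g.
Proof.
rewrite linearZ /= map_mxZ fmorphV rmorph_nat; congr (_ *: _).
rewrite linear_sum /= (big_morph _ (@map_mxD _ _ _ _ _) (@map_mx0 _ _ _ _ _)).
apply: eq_bigr => x Gx; rewrite adjmxM !unitary_adj ?groupV //.
by rewrite invgK.
Qed.

(** Every summand is put in the shape contraction, small matrix, contraction (hence the factor 1),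
    so that norm bounds apply term by term. *)
Lemma intertwiner_sub1 : intertwiner - 1%:M =
  #|G|%:R^-1 *: \sum_(x in G) 1%:M *m (rho x - sigma x) *m sigma x^-1%g.
Proof.
rewrite avg_sub; congr (_ *: _); apply: eq_bigr => x Gx.
by rewrite mul1mx mulmxBl -(repr_mxM sigma) ?groupV // mulgV repr_mx1.
Qed.

Lemma intertwiner_adj_sub1 : intertwiner^t* - 1%:M =
  #|G|%:R^-1 *: \sum_(x in G) sigma x *m (rho x^-1%g - sigma x^-1%g) *m 1%:M.
Proof.
rewrite intertwiner_adj avg_sub; congr (_ *: _); apply: eq_bigr => x Gx.
by rewrite mulmx1 mulmxBr -(repr_mxM sigma) ?groupV // mulgV repr_mx1.
Qed.

(** From T^* T - 1 = T^* (T - 1) + (T^* - 1), with the first T^* expanded as an average of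
    unitaries. *)
Lemma intertwiner_gram_sub1 : intertwiner^t* *m intertwiner - 1%:M =
  #|G|%:R^-1 *: (\sum_(x in G)
    sigma x *m rho x^-1%g *m (intertwiner - 1%:M) *m 1%:M) +
  (intertwiner^t* - 1%:M).
Proof.
have -> : intertwiner^t* *m intertwiner - 1%:M =
   intertwiner^t* *m (intertwiner - 1%:M) + (intertwiner^t* - 1%:M).
  by rewrite mulmxBr mulmx1 addrA subrK.
congr (_ + _); rewrite {1}intertwiner_adj -scalemxAl mulmx_suml.
by congr (_ *: _); apply: eq_bigr => x _; rewrite mulmx1.
Qed.

End Unitary.

(** * Diagonal sums under two-sided multiplication by contractions *)

Section Normc.
Variable R : realType.
Implicit Types z : R[i].

Lemma normc_ge0 z : 0 <= normc z.
Proof. by case: z => a b; apply: sqrtr_ge0. Qed.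

Lemma normc_real (x : R) : normc x%:C = `|x|.
Proof. by rewrite /normc /= expr0n addr0 sqrtr_sqr. Qed.

Lemma normc_sum (I : finType) (F : I -> R[i]) :
  normc (\sum_i F i) <= \sum_i normc (F i).
Proof.
elim/big_rec2: _ => [|i y x _ h]; first by rewrite normc0.
by rewrite (le_trans (le_normcD _ _)) // lerD2l.
Qed.

Lemma normc_sqr_sum (I : finType) (F : I -> R[i]) :
  (\sum_i normc (F i) ^+ 2)%:C = \sum_i `|F i| ^+ 2.
Proof. by rewrite rmorph_sum; apply: eq_bigr => i _; rewrite rmorphXn. Qed.

Lemma normc_row n (X : 'M[R[i]]_n) i : contraction X ->
  \sum_k normc (X i k) ^+ 2 <= 1.
Proof.
by move=> cX; rewrite -lecR normc_sqr_sum; apply: contraction_row.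
Qed.

Lemma normc_col n (X : 'M[R[i]]_n) k : contraction X ->
  \sum_i normc (X i k) ^+ 2 <= 1.
Proof.
by move=> cX; rewrite -lecR normc_sqr_sum; apply: contraction_col.
Qed.

(* |X_ik Y_ki| <= w_ik := (|X_ik|^2 + |Y_ki|^2) / 2, whose rows and columns
   have sums at most 1, so Jensen's inequality applies. *)
Lemma sum_powR_diag_le n (p : R) (X Y : 'M[R[i]]_n) (d : 'rV[R[i]]_n) :
  1 <= p -> contraction X -> contraction Y ->
  \sum_i normc ((X *m diag_mx d *m Y) i i) `^ p <=
  \sum_k normc (d 0 k) `^ p.
Proof.
move=> p1 cX cY.
pose w i k := 2^-1 * (normc (X i k) ^+ 2 + normc (Y k i) ^+ 2).
have w0 i k : 0 <= w i k by rewrite mulr_ge0 ?addr_ge0 ?sqr_ge0 ?invr_ge0.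
have w1 i : \sum_k w i k <= 1.
  rewrite -mulr_sumr big_split /=.
  by have := normc_row i cX; have := normc_col i cY; lra.
have w2 k : \sum_i w i k <= 1.
  rewrite -mulr_sumr big_split /=.
  by have := normc_col k cX; have := normc_row k cY; lra.
apply: (@le_trans _ _ (\sum_i \sum_k w i k * normc (d 0 k) `^ p)).
  apply: ler_sum => i _; apply: le_trans; last first.
    by apply: powR_jensen (w1 i) _ => // k; apply: normc_ge0.
  have s0 : 0 <= \sum_k w i k * normc (d 0 k).
    by apply: sumr_ge0 => k _; rewrite mulr_ge0 ?normc_ge0.
  apply: ge0_ler_powR; rewrite ?nnegrE ?normc_ge0 //; first lra.
  rewrite mxE (le_trans (normc_sum _)) //; apply: ler_sum => k _.
  rewrite mul_mx_diag mxE !normcM mulrAC ler_wpM2r ?normc_ge0 // /w.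
  by have := sqr_ge0 (normc (X i k) - normc (Y k i)); nra.
rewrite exchange_big /=; apply: ler_sum => k _.
by rewrite -mulr_suml ler_piMl ?powR_ge0.
Qed.

End Normc.

(** * Real singular values and the variational principle *)

Section SingularValues.
Variables (R : realType) (n : nat).
Implicit Type A : 'M[R[i]]_n.

Lemma singular_value_ge0 A k : 0 <= singular_value A k.
Proof. exact: sqrtr_ge0. Qed.

Lemma svE A k : sv A 0 k = (singular_value A k)%:C.
Proof.
have s0 := sv_ge0 A k.
have D2 : spectral_diag (A^t* *m A) 0 k = sv A 0 k ^+ 2 by rewrite mxE sqrtCK.
move: (s0); rewrite /singular_value D2; move/ger0_real/RRe_real => sE.
have Re0 : 0 <= complex.Re (sv A 0 k) by rewrite -lecR sE.
by rewrite -sE -rmorphXn /= sqrtr_sqr ger0_norm.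
Qed.

Lemma normc_sv_row A (f : R[i] -> R[i]) k :
  normc (sv_row A f 0 k) = normc (f (singular_value A k)%:C).
Proof. by rewrite sv_rowE svE. Qed.

(** Forward, the decomposition of [A] is absorbed into [U] and [V]; backward, the adjoints of
    [left_sv] and [right_sv] expose the singular values. The quantified side passes easily to
    products and sums. *)
Lemma schatten_normP A (p a : R) : (0 < n)%N -> 1 <= p -> 0 <= a ->
  schatten_norm p A <= a <->
  forall U V, contraction U -> contraction V ->
    \sum_i normc ((U *m A *m V) i i) `^ p <= n%:R * a `^ p.
Proof.
move=> n0 p1 a0; rewrite schatten_norm_leE //; split => [h U V cU cV|h].
  rewrite mulmx_svd; apply: le_trans h.
  apply: le_trans (sum_powR_diag_le _ p1 _ _) _.
  - exact: contractionM cU (left_sv_contraction A).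
  - exact: contractionM (right_sv_contraction A) cV.
  apply: ler_sum => k _; rewrite svE normc_real ger0_norm //.
  exact: singular_value_ge0.
apply: le_trans (h ((left_sv A)^t*) ((right_sv A)^t*) _ _); last first.
- exact/contraction_adj/right_sv_contraction.
- exact/contraction_adj/left_sv_contraction.
rewrite svd_diag; apply: ler_sum => k _.
by rewrite mxE eqxx mulr1n svE normc_real ger0_norm ?singular_value_ge0.
Qed.

Lemma idempotent_gram_singular_value A k :
  (A^t* *m A) *m (A^t* *m A) = A^t* *m A ->
  singular_value A k = 0 \/ singular_value A k = 1.
Proof.
move=> /(idempotent_gram_sv k); rewrite svE.
by case=> /complexI; [left | right].
Qed.

(** On 0 and 1 the p-th power equals the square; [p != 0] matters because 0 to the power 0 is 1. *)
Lemma idempotent_gram_sum_powR A (p : R) : p != 0 ->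
  (A^t* *m A) *m (A^t* *m A) = A^t* *m A ->
  (\sum_k singular_value A k `^ p)%:C = \tr (A^t* *m A).
Proof.
move=> p0 gramA; rewrite mxtrace_gram rmorph_sum; apply: eq_bigr => k _.
rewrite svE -rmorphXn; congr (_%:C).
case: (idempotent_gram_singular_value k gramA) => ->.
  by rewrite powR0 // expr0n.
by rewrite powR1 expr1n.
Qed.

End SingularValues.

(** * Norm inequalities drawn from the variational principle *)

Section SchattenNorm.
Variables (R : realType) (n : nat) (p : R).
Hypotheses (n0 : (0 < n)%N) (p1 : 1 <= p).
Implicit Types (A B X Y : 'M[R[i]]_n) (a b : R).

Lemma schatten_norm_contraction A X Y a : 0 <= a -> contraction X -> contraction Y ->
  schatten_norm p A <= a -> schatten_norm p (X *m A *m Y) <= a.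
Proof.
move=> a0 cX cY /(schatten_normP _ n0 p1 a0).1 hA.
apply: (schatten_normP _ n0 p1 a0).2 => U V cU cV.
rewrite !mulmxA -(mulmxA (U *m X *m A)).
exact: hA (contractionM cU cX) (contractionM cY cV).
Qed.

Lemma schatten_norm_diag_le X Y (d : 'rV[R[i]]_n) a :
  0 <= a -> contraction X -> contraction Y ->
  \sum_k normc (d 0 k) `^ p <= n%:R * a `^ p ->
  schatten_norm p (X *m diag_mx d *m Y) <= a.
Proof.
move=> a0 cX cY hd; apply: (schatten_normP _ n0 p1 a0).2 => U V cU cV.
apply: le_trans hd; rewrite !mulmxA -(mulmxA _ Y).
exact: sum_powR_diag_le p1 (contractionM cU cX) (contractionM cY cV).
Qed.

(** Covers the triangle inequality and averages at once. Rescaling each term by its bound [a i]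
    turns the sum into [S] times a convex combination with weights [c i * a i / S], to which Jensen
    applies. *)
Lemma schatten_norm_comb (I : finType) (c a : I -> R) (F : I -> 'M[R[i]]_n) :
  (forall i, 0 <= c i) -> (forall i, 0 < a i) -> 0 < \sum_i c i * a i ->
  (forall i, schatten_norm p (F i) <= a i) ->
  schatten_norm p (\sum_i (c i)%:C *: F i) <= \sum_i c i * a i.
Proof.
move=> c0 a0; set S := \sum_i _ => S0 hF.
apply: (schatten_normP _ n0 p1 (ltW S0)).2 => U V cU cV.
pose x i k := normc ((U *m F i *m V) k k).
pose w i := c i * a i / S.
have w0 i : 0 <= w i by rewrite divr_ge0 ?(ltW S0) // mulr_ge0 // ltW.
have w1 : \sum_i w i = 1 by rewrite -mulr_suml divff // gt_eqF.
have x0 i k : 0 <= x i k / a i by rewrite divr_ge0 ?normc_ge0 // ltW.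
have hx i : \sum_k (x i k / a i) `^ p <= n%:R.
  have := (schatten_normP (F i) n0 p1 (ltW (a0 i))).1 (hF i) U V cU cV.
  rewrite -ler_pdivrMr ?powR_gt0 // mulr_suml; apply: le_trans.
  apply: ler_sum => k _.
  rewrite powRM ?normc_ge0 ?invr_ge0 ?(ltW (a0 i)) //.
  by rewrite -powR_inv1 ?(ltW (a0 i)) // powRAC powR_inv1 // powR_ge0.
apply: (@le_trans _ _ (\sum_k S `^ p * \sum_i w i * (x i k / a i) `^ p)).
  apply: ler_sum => k _.
  apply: (@le_trans _ _ ((S * \sum_i w i * (x i k / a i)) `^ p)).
    have p0 : 0 <= p := le_trans ler01 p1.
    apply: ge0_ler_powR; rewrite ?nnegrE ?normc_ge0 //.
      by rewrite mulr_ge0 ?(ltW S0) // sumr_ge0 // => i _; rewrite mulr_ge0.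
    rewrite mulmx_sumr mulmx_suml summxE (le_trans (normc_sum _)) // mulr_sumr.
    apply: ler_sum => i _; rewrite -scalemxAr -scalemxAl mxE normcM normc_real.
    rewrite ger0_norm // le_eqVlt; apply/orP; left; apply/eqP; rewrite /w -/(x i k).
    by field; rewrite !gt_eqF.
  rewrite powRM ?(ltW S0) //; last by rewrite sumr_ge0 // => i _; rewrite mulr_ge0.
  by rewrite ler_wpM2l ?powR_ge0 // powR_jensen ?w1.
rewrite -mulr_sumr mulrC ler_wpM2r ?powR_ge0 // exchange_big /=.
apply: (@le_trans _ _ (\sum_i w i * n%:R)).
  by apply: ler_sum => i _; rewrite -mulr_sumr ler_wpM2l.
by rewrite -mulr_suml w1 mul1r.
Qed.

Lemma schatten_normD A B a b : 0 < a -> 0 < b ->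
  schatten_norm p A <= a -> schatten_norm p B <= b ->
  schatten_norm p (A + B) <= a + b.
Proof.
move=> a0 b0 hA hB.
have := @schatten_norm_comb bool (fun=> 1) (fun t => if t then a else b)
  (fun t => if t then A else B).
rewrite !big_bool /= !mul1r rmorph1 !scale1r; apply => //; first by case.
- by rewrite addr_gt0.
- by case.
Qed.

Lemma schatten_norm_avg (I : finType) (D : {pred I}) (F : I -> 'M[R[i]]_n) a :
  0 < a -> (0 < #|D|)%N -> (forall i, i \in D -> schatten_norm p (F i) <= a) ->
  schatten_norm p (#|D|%:R^-1 *: \sum_(i in D) F i) <= a.
Proof.
move=> a0 D0 hF; have DR : 0 < #|D|%:R :> R by rewrite ltr0n.
have [i0 i0D] := card_gt0P D0.
(* Outside [D] the coefficient is 0, and [F i0] is a filler that satisfies the bound required at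
   every index. *)
have := @schatten_norm_comb I (fun i => if i \in D then #|D|%:R^-1 else 0)
  (fun=> a) (fun i => if i \in D then F i else F i0).
have -> : \sum_i (if i \in D then #|D|%:R^-1 else 0) * a = a.
  rewrite -mulr_suml -big_mkcond sumr_const -(mulr_natr _^-1) mulVf ?gt_eqF //.
  by rewrite mul1r.
have -> : \sum_i (if i \in D then #|D|%:R^-1 else 0)%:C *:
            (if i \in D then F i else F i0) = #|D|%:R^-1 *: \sum_(i in D) F i.
  rewrite scaler_sumr [RHS]big_mkcond; apply: eq_bigr => i _.
  by case: ifP => _; rewrite ?fmorphV ?rmorph_nat // rmorph0 scale0r.
apply=> //.
- by move=> i; case: ifP => // _; rewrite invr_ge0 ltW.
- by move=> i; case: ifP => [/hF|_] //; apply: hF.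
Qed.

End SchattenNorm.

(** * Distance, defect and rank of the polar part *)

Lemma polar_part_norms (R : realType) (n : nat) (A : 'M[R[i]]_n) (p a : R) :
  (0 < n)%N -> 1 <= p -> 0 <= a ->
  schatten_norm p (A^t* *m A - 1%:M) <= a ->
  [/\ schatten_norm p (polar_part A *m (polar_part A)^t* - 1%:M) <= a,
      schatten_norm p (polar_part A - A) <= a &
      (1 - a `^ p) * n%:R <= (\rank (polar_part A))%:R].
Proof.
move=> n0 p1 a0 hA; have p0 : p != 0 by rewrite gt_eqF //; lra.
have p0' : 0 <= p by lra.
have hs : \sum_k `|1 - singular_value A k ^+ 2| `^ p <= n%:R * a `^ p.
  (* Testing with [P] and its adjoint puts s^2 - 1 on the diagonal. *)
  have := (schatten_normP _ n0 p1 a0).1 hA _ _ (right_sv_contraction A)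
    (contraction_adj (right_sv_contraction A)).
  rewrite gram_svd_sub1; apply: le_trans; apply: ler_sum => k _.
  rewrite mxE eqxx mulr1n normc_sv_row -rmorphM.
  by rewrite -(rmorph1 (real_complex R)) -rmorphB normc_real -expr2 distrC.
(* A zero singular value contributes exactly 1 to the previous sum. This count of zeros serves both
   the first claim and the rank. *)
have h0 : \sum_k (singular_value A k == 0)%:R <= n%:R * a `^ p.
  apply: le_trans hs; apply: ler_sum => k _; have [->|_] := eqVneq.
    by rewrite expr0n subr0 normr1 powR1.
  exact: powR_ge0.
have eq0E k : (sv A 0 k == 0) = (singular_value A k == 0).
  by rewrite svE fmorph_eq0.
split.
- rewrite schatten_norm_leE //; apply: le_trans h0.
  rewrite -lecR (idempotent_gram_sum_powR p0 (polar_part_coker_idem A)).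
  rewrite mxtrace_polar_part_coker rmorph_sum /=.
  by apply: ler_sum => k _; rewrite eq0E rmorph_nat.
- rewrite polar_part_sub; apply: schatten_norm_diag_le => //.
  + exact: left_sv_contraction.
  + exact: right_sv_contraction.
  apply: le_trans hs; apply: ler_sum => k _; rewrite normc_sv_row.
  rewrite -(rmorph1 (real_complex R)) -rmorphB normc_real.
  have s0 := singular_value_ge0 A k.
  apply: ge0_ler_powR; rewrite ?nnegrE //.
  have -> : 1 - singular_value A k ^+ 2 =
    (1 - singular_value A k) * (1 + singular_value A k) by ring.
  by rewrite normrM ler_peMr // ger0_norm; lra.
- have := mxrank_polar_part A; under eq_bigr do rewrite eq0E.
  rewrite -(ler_nat R) natrD natr_sum.
  by rewrite mulrBl mul1r [_ * n%:R]mulrC; lra.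
Qed.

(** * Norm estimates for the averaged intertwiner *)

Section IntertwinerNorm.
Variables (R : realType) (gT : finGroupType) (G : {group gT}) (n : nat).
Variables rho sigma : mx_representation R[i] G n.
Hypotheses (urho : unitary_repr rho) (usigma : unitary_repr sigma).
Variables (p eps : R).
Hypotheses (n0 : (0 < n)%N) (p1 : 1 <= p) (eps0 : 0 < eps).
Hypothesis hclose :
  forall x, x \in G -> schatten_norm p (rho x - sigma x) <= eps.
Let T := intertwiner rho sigma.

Lemma unitary_repr_contraction (tau : mx_representation R[i] G n) x :
  unitary_repr tau -> x \in G -> contraction (tau x).
Proof. by move=> u Gx; apply/unitarymx_contraction/u. Qed.

Lemma intertwiner_sub1_le : schatten_norm p (T - 1%:M) <= eps.
Proof.
rewrite /T intertwiner_sub1.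
apply: (schatten_norm_avg n0 p1 eps0) => [|x Gx]; first exact: cardG_gt0.
apply: (schatten_norm_contraction n0 p1 (ltW eps0)); last exact: hclose.
  exact: contraction1.
by apply: unitary_repr_contraction; rewrite ?groupV.
Qed.

Lemma intertwiner_adj_sub1_le : schatten_norm p (T^t* - 1%:M) <= eps.
Proof.
rewrite /T (intertwiner_adj_sub1 urho usigma).
apply: (schatten_norm_avg n0 p1 eps0) => [|x Gx]; first exact: cardG_gt0.
apply: (schatten_norm_contraction n0 p1 (ltW eps0)).
- exact: unitary_repr_contraction.
- exact: contraction1.
- by apply: hclose; rewrite groupV.
Qed.

Lemma intertwiner_gram_sub1_le : schatten_norm p (T^t* *m T - 1%:M) <= 2 * eps.
Proof.
rewrite /T (intertwiner_gram_sub1 urho usigma) mulr_natl mulr2n.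
(* One [eps] comes from the unitary translates of T - 1, the other from T^* - 1. *)
apply: (schatten_normD n0 p1 eps0 eps0); last exact: intertwiner_adj_sub1_le.
apply: (schatten_norm_avg n0 p1 eps0) => [|x Gx]; first exact: cardG_gt0.
apply: (schatten_norm_contraction n0 p1 (ltW eps0)).
- by apply: contractionM; apply: unitary_repr_contraction; rewrite ?groupV.
- exact: contraction1.
- exact: intertwiner_sub1_le.
Qed.

End IntertwinerNorm.

Theorem theorem7p3 (R : realType) (gT : finGroupType) (G : {group gT})
    (p : R) (hp : 1 <= p) (eps : R) (heps : 0 < eps) (n : nat) (hn : (0 < n)%N)
    (rho sigma : mx_representation R[i] G n)
    (hrho : unitary_repr rho) (hsigma : unitary_repr sigma)
    (hclose : forall x, x \in G -> schatten_norm p (rho x - sigma x) <= eps) :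
  (exists T' : 'M[R[i]]_n,
     [/\ eta_unitary p (2 * eps) T',
         schatten_norm p (T' - 1%:M) <= 3 * eps &
         forall x, x \in G -> rho x *m T' = T' *m sigma x]) /\
  (exists (m : nat) (tau : mx_representation R[i] G m),
     [/\ (1 - (2 * eps) `^ p) * n%:R <= m%:R,
         component tau rho & component tau sigma]).
Proof.
pose T := intertwiner rho sigma; pose T' := polar_part T.
have eps2 : 0 < 2 * eps by rewrite mulr_gt0.
have [cokerT' subT' rkT'] := polar_part_norms hn hp (ltW eps2)
  (intertwiner_gram_sub1_le hrho hsigma hn hp heps hclose).
have homT' : forall x, x \in G -> rho x *m T' = T' *m sigma x.
  exact: (polar_part_hom hrho hsigma (intertwinerP rho sigma)).
split.
  exists T'; split; last exact: homT'.
    split; last exact: cokerT'.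
    by move=> k; apply/idempotent_gram_singular_value/polar_part_gram_idem.
  (* [T'] is within [2 * eps] of [T], and [T] within [eps] of 1. *)
  have -> : T' - 1%:M = (T' - T) + (T - 1%:M) by rewrite addrA subrK.
  have -> : 3 * eps = 2 * eps + eps by ring.
  apply: (schatten_normD hn hp eps2 heps subT').
  exact: (intertwiner_sub1_le hsigma hn hp heps hclose).
have [V [W [modV [modW [rkV simVW]]]]] :=
  partial_isometry_rsim hrho hsigma (polar_partK T) homT'.
(* The common component is [rho] restricted to [V], of dimension the rank of [T']; [simVW] places it
   inside [sigma]. *)
exists (\rank V), (submod_repr modV); split; first by rewrite rkV.
  by exists V, modV; apply: mx_rsim_refl.
by exists W, modW.
Qed.
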